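(* Let $M:=\mathbb{C}^n/2\pi i\,\mathbb{Z}^n\simeq(\mathbb{C}^* )^n$ be endowed with a Kähler metric such that the $\mathbb{T}^n$-action is Hamiltonian. Let $\mathrm{Vol}:\mathbb{R}^n\to(0,\infty)$ denote the standard Riemannian volume functional restricted to the set of canonical $n$-tori, i.e. $\mathrm{Vol}(x)$ is the $n$-dimensional Riemannian volume of $L_x$. Then: (1) $\mathrm{Ric}\le 0$ if and only if $\log\mathrm{Vol}$ is convex on $\mathbb{R}^n$; and in this case $\mathrm{Vol}$ is convex. (2) $\mathrm{Ric}\ge 0$ if and only if $\log\mathrm{Vol}$ is concave on $\mathbb{R}^n$; and in this case $1/\mathrm{Vol}$ is convex. In particular, if $\mathrm{Ric}=0$ then $\log\mathrm{Vol}$ is an affine function of $x\in\mathbb{R}^n$.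
   Context: Write $z=x+iy$ for the coordinates on $\mathbb{C}^n/2\pi i\,\mathbb{Z}^n$, which is identified with $(\mathbb{C}^* )^n$ via $z\mapsto(e^{z_1},\dots,e^{z_n})$, so $x_i=\log r_i$. The group $\mathbb{T}^n=\mathbb{R}^n/2\pi\mathbb{Z}^n$ acts by translation in $y$. The canonical $n$-tori are the $\mathbb{T}^n$-orbits $L_x=\{x\}\times(\mathbb{R}^n/2\pi\mathbb{Z}^n)$, $x\in\mathbb{R}^n$. Let $\omega$ be the Kähler form. The action is Hamiltonian if there is a moment map, i.e. a $\mathbb{T}^n$-invariant smooth map $\mu:M\to(\mathrm{Lie}(\mathbb{T}^n))^*$ with $d(\mu\cdot X)=\omega(\tilde X,\cdot)$ for all $X\in\mathrm{Lie}(\mathbb{T}^n)$, where $\tilde X$ is the fundamental vector field of $X$. $\mathrm{Ric}$ is the Ricci curvature of the Kähler metric, and $\mathrm{Ric}\le 0$ ($\ge 0$) means negative (positive) semi-definite at every point of $M$. *)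

(* Defs.v *)
From HB Require Import structures.
From mathcomp Require Import all_boot all_order all_algebra.
From mathcomp Require Import all_classical all_reals all_analysis.

Set Implicit Arguments.
Unset Strict Implicit.
Unset Printing Implicit Defensive.

Import Order.TTheory GRing.Theory Num.Theory.
Import numFieldNormedType.Exports.

Local Open Scope classical_set_scope.
Local Open Scope ring_scope.

(* Tangent vectors, like points, are row vectors, and matrices act on the
   right: the value of a bilinear form A on (u, v) is u A v^T. *)
Definition bilin (R : realType) (m : nat) (A : 'M[R]_m) (u v : 'rV[R]_m) : R :=
  (u *m A *m v^T) 0 0.

Definition partial (R : realType) (m : nat) (i : 'I_m) (f : 'rV[R]_m -> R) :
    'rV[R]_m -> R :=
  fun p => 'D_(delta_mx 0 i) f p.

Definition iter_partial (R : realType) (m : nat) (s : seq 'I_m)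
    (f : 'rV[R]_m -> R) : 'rV[R]_m -> R :=
  foldr (@partial R m) f s.

Definition smooth (R : realType) (m : nat) (f : 'rV[R]_m -> R) : Prop :=
  forall s : seq 'I_m,
    continuous (iter_partial s f) /\
    (forall (i : 'I_m) (p : 'rV[R]_m),
       derivable (iter_partial s f) p (delta_mx 0 i)).

Definition smooth_mx (R : realType) (m k l : nat)
    (F : 'rV[R]_m -> 'M[R]_(k, l)) : Prop :=
  forall (i : 'I_k) (j : 'I_l), smooth (fun p => F p i j).

(* Riemannian geometry in global coordinates: [G p] is the Gram matrix of the
   metric at [p] in the coordinate frame. *)

Definition riemannian_metric (R : realType) (m : nat)
    (G : 'rV[R]_m -> 'M[R]_m) : Prop :=
  [/\ smooth_mx G,
      forall p, (G p)^T = G p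
    & forall p v, v != 0 -> 0 < bilin (G p) v v].

(* Gamma^k_{ij} of the Levi-Civita connection *)
Definition christoffel (R : realType) (m : nat) (G : 'rV[R]_m -> 'M[R]_m)
    (k i j : 'I_m) (p : 'rV[R]_m) : R :=
  2^-1 * \sum_(l < m) invmx (G p) k l *
    (partial i (fun q => G q j l) p + partial j (fun q => G q i l) p
     - partial l (fun q => G q i j) p).

(* The d_l-component of Rm(d_i, d_j) d_k, where
   Rm(X, Y) Z = nabla_X nabla_Y Z - nabla_Y nabla_X Z - nabla_[X,Y] Z. *)
Definition riemann (R : realType) (m : nat) (G : 'rV[R]_m -> 'M[R]_m)
    (i j k l : 'I_m) (p : 'rV[R]_m) : R :=
  partial i (christoffel G l j k) p - partial j (christoffel G l i k) p
  + \sum_(a < m) (christoffel G l i a p * christoffel G a j k p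
                  - christoffel G l j a p * christoffel G a i k p).

(* Ric(Y, Z) = trace of X |-> Rm(X, Y) Z; it is positive on round spheres. *)
Definition ricci (R : realType) (m : nat) (G : 'rV[R]_m -> 'M[R]_m)
    (p : 'rV[R]_m) : 'M[R]_m :=
  \matrix_(j < m, k < m) \sum_(i < m) riemann G i j k i p.

Definition ricci_nonpos (R : realType) (m : nat) (G : 'rV[R]_m -> 'M[R]_m) :
    Prop :=
  forall p v, bilin (ricci G p) v v <= 0.

Definition ricci_nonneg (R : realType) (m : nat) (G : 'rV[R]_m -> 'M[R]_m) :
    Prop :=
  forall p v, 0 <= bilin (ricci G p) v v.

Definition ricci_flat (R : realType) (m : nat) (G : 'rV[R]_m -> 'M[R]_m) :
    Prop :=
  forall p, ricci G p = 0.

(* The manifold M = C^n / 2 pi i Z^n. A point z = x + iy of C^n is the row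
   [row_mx x y] of 'rV_(n + n). The frame d/dx_1 .. d/dx_n, d/dy_1 .. d/dy_n is
   globally defined on M, so tensor fields on M are the component fields on
   'rV_(n + n) that are periodic in y with respect to 2 pi Z^n. *)

Definition lattice_periodic (R : realType) (n : nat) (T : Type)
    (F : 'rV[R]_(n + n) -> T) : Prop :=
  forall (p : 'rV[R]_(n + n)) (k : 'rV[int]_n),
    F (p + row_mx 0 ((2 * pi) *: map_mx intr k)) = F p.

(* v *m cplxJ is the image of v under J : d/dx_j |-> d/dy_j |-> - d/dx_j. *)
Definition cplxJ (R : realType) (n : nat) : 'M[R]_(n + n) :=
  block_mx 0 1%:M (- 1%:M) 0.

(* omega(u, v) = g(J u, v) *)
Definition kahler_form (R : realType) (n : nat)
    (G : 'rV[R]_(n + n) -> 'M[R]_(n + n)) (p : 'rV[R]_(n + n)) :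
    'M[R]_(n + n) :=
  cplxJ R n *m G p.

(* (dw)(d_i, d_j, d_k) = 0 for a 2-form w with skew-symmetric matrix W *)
Definition closed_2form (R : realType) (m : nat) (W : 'rV[R]_m -> 'M[R]_m) :
    Prop :=
  forall (p : 'rV[R]_m) (i j k : 'I_m),
    partial i (fun q => W q j k) p + partial j (fun q => W q k i) p
    + partial k (fun q => W q i j) p = 0.

Definition kahler_metric (R : realType) (n : nat)
    (G : 'rV[R]_(n + n) -> 'M[R]_(n + n)) : Prop :=
  [/\ lattice_periodic G,
      riemannian_metric G,
      forall p u v, bilin (G p) (u *m cplxJ R n) (v *m cplxJ R n)
                    = bilin (G p) u v
    & closed_2form (kahler_form G)].

(* Lie(T^n) = R^n acts through the fundamental fields sum_j X_j d/dy_j. *)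
Definition fundamental_field (R : realType) (n : nat) (X : 'rV[R]_n) :
    'rV[R]_(n + n) :=
  row_mx 0 X.

(* A covector on Lie(T^n) = R^n is a row vector, paired by mu X^T. Invariance
   under all translations in y makes mu descend to M. *)
Definition moment_map (R : realType) (n : nat)
    (G : 'rV[R]_(n + n) -> 'M[R]_(n + n)) (mu : 'rV[R]_(n + n) -> 'rV[R]_n) :
    Prop :=
  [/\ smooth_mx mu,
      forall (p : 'rV[R]_(n + n)) (theta : 'rV[R]_n),
        mu (p + row_mx 0 theta) = mu p
    & forall (X : 'rV[R]_n) (p v : 'rV[R]_(n + n)),
        'D_v (fun q => (mu q *m X^T) 0 0 : R) p
        = bilin (kahler_form G p) (fundamental_field X) v].

Definition hamiltonian_torus_action (R : realType) (n : nat)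
    (G : 'rV[R]_(n + n) -> 'M[R]_(n + n)) : Prop :=
  exists mu : 'rV[R]_(n + n) -> 'rV[R]_n, moment_map G mu.

(* Iterated integral over the cube [a, b]^n *)
Fixpoint cube_integral (R : realType) (a b : R) (n : nat) :
    ('rV[R]_n -> R) -> R :=
  match n return ('rV[R]_n -> R) -> R with
  | 0%N => fun f => f 0
  | n'.+1 => fun f =>
      \int[@lebesgue_measure R]_(t in `[a, b])
        cube_integral a b (fun v : 'rV[R]_n' => f (row_mx t%:M v))
  end.

(* The induced metric on L_x has Gram matrix (g(d/dy_i, d/dy_j))_ij, the lower
   right block of G, in the angular coordinates y in [0, 2 pi]^n. *)
Definition torus_vol (R : realType) (n : nat)
    (G : 'rV[R]_(n + n) -> 'M[R]_(n + n)) (x : 'rV[R]_n) : R :=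
  cube_integral 0 (2 * pi)
    (fun y : 'rV[R]_n => Num.sqrt (\det (drsubmx (G (row_mx x y))))).

Definition convex_on_Rn (R : realType) (n : nat) (f : 'rV[R]_n -> R) : Prop :=
  @convex_function R 'rV[R]_n setT f.

Definition concave_on_Rn (R : realType) (n : nat) (f : 'rV[R]_n -> R) : Prop :=
  convex_on_Rn (fun x => - f x).

Definition affine_on_Rn (R : realType) (n : nat) (f : 'rV[R]_n -> R) : Prop :=
  exists (a : 'rV[R]_n) (b : R), forall x, f x = (a *m x^T) 0 0 + b.

(* Main.v *)
Require Import Defs.
From mathcomp Require Import all_boot all_order all_algebra.
From mathcomp Require Import all_classical all_reals all_analysis.
From mathcomp Require Import ring lra.

Set Implicit Arguments.
Unset Strict Implicit.
Unset Printing Implicit Defensive.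

Import Order.TTheory GRing.Theory Num.Theory.
Import numFieldNormedType.Exports.

Local Open Scope classical_set_scope.
Local Open Scope ring_scope.

(** The Hamiltonian condition collapses the geometry to one matrix on the base.
With z = x + i y, a moment map mu satisfies d mu_j(v) = omega(d/dy_j, v)
= - g(d/dx_j, v). As mu does not depend on y, this gives g(d/dx_j, d/dy_k) = 0
and shows that H_jk = g(d/dx_j, d/dx_k) is constant along the tori; invariance of
g under J then forces g = diag(H, H) ([metric_block], [metric_invariant]).
Closedness of omega says that T_ijk = d_i H_jk is totally symmetric
([dmetric_sym], [dmetric_closed]), i.e. that H is locally a Hessian.

The restriction of g to L_x has Gram matrix H(x), so
Vol(x) = (2 pi)^n sqrt(det H(x)) and log Vol = const + 1/2 log det H
([ln_torus_vol]). On the other side, all Christoffel symbols of g are, up to sign,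
either 0 or those of H, namely Gamma^k_ij = 1/2 sum_l H^kl T_ijl. In the Ricci
tensor the quadratic terms and the divergence sum_i d_i Gamma^i_jk cancel; the
cancellation ([ricci_cancellation]) is where total symmetry of T and equality of
mixed second derivatives are used. What is left is
- d_j (sum_i Gamma^i_ik), and sum_i Gamma^i_ik = 1/2 d_k log det H by Jacobi's
formula. Hence Ric = diag(Q, Q) with Q = - Hess (log Vol), without mixed terms
([ricci_ll], [ricci_rr], [ricci_lr], [ricci_rl]).

So the sign of Ric is the opposite of the sign of the Hessian of log Vol, and the
equivalences are the second derivative criterion for convexity
([derive2_ge0_convex], [convex_derive2_ge0]). Vol = exp (log Vol) and
1 / Vol = exp (- log Vol) are convex because exp is convex and increasing, and a
function whose Hessian vanishes is affine ([derive2_eq0_affine]).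

All functions of x are kept as functions on R^(n + n) that are invariant under
translations in y, so that a single differential calculus serves both for the
metric and for log det H. Indices of the form [lshift n i] stand for d/dx_i and
those of the form [rshift n i] for d/dy_i; lemma suffixes l and r follow this
convention. *)

(** * Directional derivatives *)

Section DirectionalDerivatives.
Variables (R : realType) (V : normedModType R).
Implicit Types (f : V -> R) (p u v w : V).

(** Transfers one-variable calculus (mean value theorem, chain rule) to directional
derivatives. *)
Lemma is_derive_lineP f p v (t : R) df :
  is_derive (p + t *: v) v f df <-> is_derive t 1 (fun s : R => f (p + s *: v)) df.
Proof.
have E : (fun h : R => h^-1 *: ((f \o shift (p + t *: v)) (h *: v) - f (p + t *: v)))
  = (fun h : R => h^-1 *: (((fun s : R => f (p + s *: v)) \o shift t) (h *: 1)
                          - f (p + t *: v))).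
  apply/funext => h /=; congr (_ *: (f _ - _)).
  by rewrite [h *: 1]mulr1 scalerDl addrCA.
by split => -[D d]; split; move: D d; rewrite /derivable /derive E.
Qed.

Lemma derivable_line f p v (t : R) : derivable f (p + t *: v) v ->
  is_derive t 1 (fun s : R => f (p + s *: v)) ('D_v f (p + t *: v)).
Proof. by move=> /derivableP/is_derive_lineP. Qed.

Lemma mean_value_along f p v (h : R) : (forall q, derivable f q v) ->
  exists2 s : R, `|s| <= `|h| &
    f (p + h *: v) - f p = h * 'D_v f (p + s *: v).
Proof.
move=> df; pose g (t : R) := f (p + t *: v).
have dg (t : R) : is_derive t 1 g ('D_v f (p + t *: v)) by apply: derivable_line.
have cg (i : interval R) : {within [set` i], continuous g}.
  by apply: derivable_within_continuous => t _; apply: ex_derive.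
have [h0|h0] := leP 0 h.
- have [s /itvP si] := MVT_segment h0 (fun t _ => dg t) (cg `[0, h]).
  rewrite /g scale0r addr0 subr0 mulrC => ->; exists s => //.
  by rewrite !ger0_norm ?si.
- have [s /itvP si] := MVT_segment (ltW h0) (fun t _ => dg t) (cg `[h, 0]).
  rewrite /g scale0r addr0 sub0r mulrN mulrC => /eqP.
  rewrite -eqr_opp opprB opprK => /eqP ->; exists s => //.
  have [hs s0] : h <= s /\ s <= 0 by rewrite !si.
  by rewrite !ler0_norm ?(ltW h0)// lerN2.
Qed.

(** The mean value theorem yields intermediate points whose coordinates are bounded
by the increments; all that is ever needed of them is that they tend to the base
point. *)
Lemma cvg_small_box p u v (s t : R -> R) :
  (forall h, `|s h| <= `|h|) -> (forall h, `|t h| <= `|h|) ->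
  p + s h *: u + t h *: v @[h --> 0^'] --> p.
Proof.
have cvg0 (r : R -> R) : (forall h, `|r h| <= `|h|) -> r @ 0^' --> (0 : R).
  move=> rh; apply/cvgr0Pnorm_le => e e0; near=> h.
  by apply: le_trans (rh h) _; near: h; apply: dnbhs0_le.
move=> /cvg0 cs /cvg0 ct.
rewrite -[X in _ --> X]addr0 -[X in _ --> X + _]addr0.
apply: cvgD; last by rewrite -(scale0r v); apply: cvgZr_tmp.
by apply: cvgD; [exact: cvg_cst|rewrite -(scale0r u); apply: cvgZr_tmp].
Unshelve. all: by end_near.
Qed.

(** A derivative in direction [v] that exists everywhere and is continuous can be
added to the derivative in any other direction: the increment from [p + h u] to
[p + h u + h v] is [h] times a value of ['D_v f] at a point near [p]. Iterating over
the coordinates gives differentiability of C^1 functions. *)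
Lemma is_derive_addl f u v p : (forall q, derivable f q v) ->
  continuous ('D_v f) -> derivable f p u ->
  is_derive p (u + v) f ('D_u f p + 'D_v f p).
Proof.
move=> dv cv du.
have /choice[s Hs] : forall h : R, exists s : R, `|s| <= `|h| /\
    f (p + h *: u + h *: v) - f (p + h *: u) = h * 'D_v f (p + h *: u + s *: v).
  by move=> h; have [s ? ?] := mean_value_along (p + h *: u) h dv; exists s.
have cvp : (fun h : R => p + h *: u + s h *: v) @ 0^' --> p.
  by apply: cvg_small_box => // h; case: (Hs h).
have cD : (fun h : R => 'D_v f (p + h *: u + s h *: v)) @ 0^' --> 'D_v f p.
  exact: cvg_comp cvp (cv p).
have : (fun h : R => h^-1 *: ((f \o shift p) (h *: (u + v)) - f p)) @ 0^' -->
   'D_u f p + 'D_v f p.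
  have cu : (fun h : R => h^-1 *: ((f \o shift p) (h *: u) - f p)) @ 0^' -->
    'D_u f p by exact: du.
  apply: cvg_trans; last exact: (cvgD cu cD).
  apply: near_eq_cvg; near=> h.
  have h0 : h != 0 by near: h; apply: nbhs_dnbhs_neq.
  have [_ E] := Hs h.
  rewrite /=; have -> : (h *: (u + v) + p) = p + h *: u + h *: v.
    by rewrite scalerDr addrC addrA.
  rewrite /= -[LHS]/(h^-1 * (f (h *: u + p) - f p) + 'D_v f (p + h *: u + s h *: v)).
  rewrite -(mulKf h0 ('D_v f _)) -E [h *: u + p]addrC.
  by rewrite -mulrDr [X in _ * X]addrC addrA subrK.
move=> H; split; first by apply/cvg_ex; eexists; exact: H.
exact/cvg_lim/H.
Unshelve. all: by end_near.
Qed.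

Lemma is_derive_scale f p v (c : R) : derivable f p v ->
  is_derive p (c *: v) f (c * 'D_v f p).
Proof.
move=> df; have := @is_derive_lineP f p (c *: v) 0 (c * 'D_v f p).
rewrite scale0r addr0 => ->.
have -> : (fun s : R => f (p + s *: (c *: v))) =
    (fun s : R => f (p + s *: v)) \o (fun s : R => s * c).
  by apply/funext => s /=; rewrite scalerA.
rewrite mulrC; apply: is_derive1_comp.
  rewrite mul0r; apply/is_derive_lineP; rewrite scale0r addr0.
  exact: derivableP.
have H : is_derive (0 : R) 1 (id * cst c : R -> R) (0 *: 0 + c *: 1).
  exact: is_deriveM.
by apply: is_derive_eq H _; rewrite scaler0 add0r [LHS]mulr1.
Qed.

(** Two uses of the mean value theorem: first for [q |-> f (q + k v) - f q] in
direction [u], then for ['D_u f] in direction [v]. *)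
Lemma second_difference f p u v (h k : R) :
  (forall q, derivable f q u) -> (forall q, derivable ('D_u f) q v) ->
  exists s : R, exists t : R, [/\ `|s| <= `|h|, `|t| <= `|k| &
    f (p + h *: u + k *: v) - f (p + k *: v) - (f (p + h *: u) - f p)
    = h * k * 'D_v ('D_u f) (p + s *: u + t *: v)].
Proof.
move=> du dv.
pose g (q : V) := f (q + k *: v) - f q.
have dg q : is_derive q u g ('D_u f (q + k *: v) - 'D_u f q).
  apply: is_deriveB; last exact: derivableP.
  have E : (fun h0 : R => h0^-1 *: (((fun q => f (q + k *: v)) \o shift q) (h0 *: u)
     - f (q + k *: v))) = (fun h0 : R => h0^-1 *: ((f \o shift (q + k *: v)) (h0 *: u)
     - f (q + k *: v))) by apply/funext=> t /=; rewrite addrA.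
  by have := du (q + k *: v); split; rewrite /derivable /derive E.
have dg' q : derivable g q u by exact: ex_derive.
have [s sh E] := mean_value_along p h dg'.
have [t tk E'] := mean_value_along (p + s *: u) k dv.
exists s, t; split => //.
rewrite -mulrA -E'; move: E; rewrite (@derive_val _ _ _ _ _ _ _ (dg _)) => <-.
by rewrite /g; ring.
Qed.

(** The second difference is symmetric in [u] and [v], and it is nonnegative when
[u = v] and [f] is convex; its limit therefore gives both the symmetry of second
derivatives and one half of the convexity criterion. *)
Lemma second_difference_cvg f p u v :
  (forall q, derivable f q u) -> (forall q, derivable ('D_u f) q v) ->
  continuous ('D_v ('D_u f)) ->
  (h * h)^-1 * (f (p + h *: u + h *: v) - f (p + h *: v) - (f (p + h *: u) - f p))
    @[h --> 0^'] --> 'D_v ('D_u f) p.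
Proof.
move=> du dv cdv.
have /choice[s /choice[t Hst]] := fun h : R => second_difference p h h du dv.
have cp := @cvg_small_box p u v s t (fun h => let: And3 a _ _ := Hst h in a)
  (fun h => let: And3 _ b _ := Hst h in b).
apply: cvg_trans; last exact: cvg_comp cp (cdv p).
apply: near_eq_cvg; near=> h.
have h0 : h != 0 by near: h; apply: nbhs_dnbhs_neq.
by have [_ _ ->] := Hst h; rewrite /= mulKf ?mulf_neq0.
Unshelve. all: by end_near.
Qed.

Lemma derive_comm f p u v :
  (forall q, derivable f q u) -> (forall q, derivable f q v) ->
  (forall q, derivable ('D_u f) q v) -> (forall q, derivable ('D_v f) q u) ->
  continuous ('D_v ('D_u f)) -> continuous ('D_u ('D_v f)) ->
  'D_v ('D_u f) p = 'D_u ('D_v f) p.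
Proof.
move=> du dv duv dvu cuv cvu.
have c1 := second_difference_cvg du duv cuv.
have c2 := second_difference_cvg dv dvu cvu.
apply: (cvg_unique _ (c1 p)) => //; apply: cvg_trans; last exact: c2 p.
apply: near_eq_cvg; near=> h; congr (_ * _).
by rewrite -!addrA [h *: u + _]addrC !addrA; ring.
Unshelve. all: by end_near.
Qed.

End DirectionalDerivatives.

(** * Functions of class C^k *)

Section FiniteOrderSmoothness.
Variables (R : realType) (m : nat).
Implicit Types (f g : 'rV[R]_m -> R) (p v w : 'rV[R]_m) (k : nat).

(** Recursion on the order makes closure under products, inverses and logarithms a
short induction, since the derivative of each is built from functions of lower
order. *)
Fixpoint class_C k f : Prop :=
  continuous f /\
  match k with
  | 0%N => True
  | k'.+1 => forall i : 'I_m,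
      (forall p, derivable f p (delta_mx 0 i)) /\ class_C k' (partial i f)
  end.

Lemma class_C_continuous k f : class_C k f -> continuous f.
Proof. by case: k => [|k] []. Qed.

Arguments class_C_continuous [k f] _ _.

Lemma class_C_derivable k f (i : 'I_m) p :
  class_C k.+1 f -> derivable f p (delta_mx 0 i).
Proof. by case=> _ /(_ i)[]. Qed.

Arguments class_C_derivable [k f] i p _.

Lemma class_C_partial k f (i : 'I_m) : class_C k.+1 f -> class_C k (partial i f).
Proof. by case=> _ /(_ i)[]. Qed.

Lemma class_CW k f : class_C k.+1 f -> class_C k f.
Proof.
elim: k f => [|k IH] f [cf df]; first by [].
by split=> // i; have [d /IH] := df i.
Qed.

Lemma smooth_class_C k f : smooth f -> class_C k f.
Proof.
elim: k f => [|k IH] f sf; first by have [] := sf [::].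
split; first by have [] := sf [::].
move=> i; split; first by have [_] := sf [::]; apply.
by apply: IH => s; have := sf (rcons s i); rewrite /iter_partial foldr_rcons.
Qed.

Lemma class_C_cst k (c : R) : class_C k (fun=> c).
Proof.
elim: k c => [|k IH] c; first by split=> //; exact: cst_continuous.
split=> [|i]; first exact: cst_continuous.
split=> [p|]; first exact: derivable_cst.
have -> : partial i (fun=> c) = (fun=> 0) by apply/funext => p; apply: derive_cst.
exact: IH.
Qed.

Lemma partialD f g (i : 'I_m) p :
  derivable f p (delta_mx 0 i) -> derivable g p (delta_mx 0 i) ->
  partial i (fun q => f q + g q) p = partial i f p + partial i g p.
Proof. exact: deriveD. Qed.

Lemma partialM f g (i : 'I_m) p :
  derivable f p (delta_mx 0 i) -> derivable g p (delta_mx 0 i) ->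
  partial i (fun q => f q * g q) p = f p * partial i g p + partial i f p * g p.
Proof. by move=> df dg; rewrite [X in _ = _ + X]mulrC; apply: deriveM. Qed.

Lemma class_CD k f g : class_C k f -> class_C k g -> class_C k (fun q => f q + g q).
Proof.
elim: k f g => [|k IH] f g Cf Cg.
  by split=> // p; exact: continuousD (class_C_continuous Cf p) (class_C_continuous Cg p).
split=> [p|i].
  by exact: continuousD (class_C_continuous Cf p) (class_C_continuous Cg p).
split=> [p|]; first by apply: derivableD; [exact: (class_C_derivable _ _ Cf)|exact: (class_C_derivable _ _ Cg)].
have -> : partial i (fun q => f q + g q) = fun q => partial i f q + partial i g q.
  by apply/funext => p; apply: partialD; [exact: (class_C_derivable _ _ Cf)|exact: (class_C_derivable _ _ Cg)].
by apply: IH; apply: class_C_partial.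
Qed.

Lemma class_CM k f g : class_C k f -> class_C k g -> class_C k (fun q => f q * g q).
Proof.
elim: k f g => [|k IH] f g Cf Cg.
  by split=> // p; exact: continuousM (class_C_continuous Cf p) (class_C_continuous Cg p).
split=> [p|i].
  by exact: continuousM (class_C_continuous Cf p) (class_C_continuous Cg p).
split=> [p|]; first by apply: derivableM; [exact: (class_C_derivable _ _ Cf)|exact: (class_C_derivable _ _ Cg)].
have -> : partial i (fun q => f q * g q) =
    fun q => f q * partial i g q + partial i f q * g q.
  by apply/funext => p; apply: partialM; [exact: (class_C_derivable _ _ Cf)|exact: (class_C_derivable _ _ Cg)].
by apply: class_CD; apply: IH; do ?[exact: class_CW|exact: class_C_partial].
Qed.

Lemma class_CN k f : class_C k f -> class_C k (fun q => - f q).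
Proof.
move=> Cf; under eq_fun do rewrite -mulN1r.
by apply: class_CM => //; apply: class_C_cst.
Qed.

Lemma class_C_sum k (I : Type) (r : seq I) (F : I -> 'rV[R]_m -> R) :
  (forall i, class_C k (F i)) -> class_C k (fun q => \sum_(i <- r) F i q).
Proof.
move=> CF; elim: r => [|a r IH].
  by under eq_fun do rewrite big_nil; apply: class_C_cst.
by under eq_fun do rewrite big_cons; apply: class_CD.
Qed.

Lemma class_C_prod k (I : Type) (r : seq I) (F : I -> 'rV[R]_m -> R) :
  (forall i, class_C k (F i)) -> class_C k (fun q => \prod_(i <- r) F i q).
Proof.
move=> CF; elim: r => [|a r IH].
  by under eq_fun do rewrite big_nil; apply: class_C_cst.
by under eq_fun do rewrite big_cons; apply: class_CM.
Qed.

(** The inverse occurs in its own derivative [- (1/f)^2 f'], which by induction has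
one order less. *)
Lemma class_CV k f : (forall p, f p != 0) -> class_C k f ->
  class_C k (fun q => (f q)^-1).
Proof.
move=> f0; elim: k => [|k IH] Cf.
  by split=> // p; apply: continuousV => //; exact: (class_C_continuous Cf).
split=> [p|i]; first by apply: continuousV => //; exact: (class_C_continuous Cf).
split=> [p|]; first by apply: derivableV => //; apply: class_C_derivable _ _ Cf.
have -> : partial i (fun q => (f q)^-1) =
    fun q => (fun=> -1) q * (((f q)^-1 * (f q)^-1) * partial i f q).
  apply/funext => p; rewrite /partial deriveV//; last exact: class_C_derivable _ _ Cf.
  by rewrite -exprVn expr2 mulN1r -[LHS]/(_ * _) mulNr.
have Cf' := class_CW Cf.
apply: class_CM; first exact: class_C_cst.
apply: class_CM; last exact: class_C_partial.
by apply: class_CM; apply: IH.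
Qed.

Lemma is_derive_ln f p v : 0 < f p -> derivable f p v ->
  is_derive p v (fun q => ln (f q)) ((f p)^-1 * 'D_v f p).
Proof.
move=> fp df; have := is_derive_lineP (fun q => ln (f q)) p v 0 ((f p)^-1 * 'D_v f p).
rewrite scale0r addr0 => ->.
have Dln : is_derive (f (p + 0 *: v)) 1 (@ln R) (f p)^-1.
  by rewrite scale0r addr0; apply: is_derive1_ln.
have Df : is_derive (0 : R) 1 (fun s : R => f (p + s *: v)) ('D_v f p).
  have := is_derive_lineP f p v 0 ('D_v f p).
  by rewrite scale0r addr0 => <-; apply: derivableP.
exact: is_derive1_comp Dln Df.
Qed.

Lemma partial_ln f (i : 'I_m) p : 0 < f p -> derivable f p (delta_mx 0 i) ->
  partial i (fun q => ln (f q)) p = (f p)^-1 * partial i f p.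
Proof. by move=> fp df; apply: (@derive_val _ _ _ _ _ _ _ (is_derive_ln fp df)). Qed.

Lemma class_C_ln k f : (forall p, 0 < f p) -> class_C k f ->
  class_C k (fun q => ln (f q)).
Proof.
move=> f0 Cf; have cl : continuous (fun q => ln (f q)).
  move=> p; apply: (@continuous_comp _ _ _ f (@ln R)).
    exact: (class_C_continuous Cf).
  exact: continuous_ln.
case: k Cf => [|k] Cf //; split=> // i; split=> [p|].
  by have [] := is_derive_ln (f0 p) (class_C_derivable i p Cf).
have -> : partial i (fun q => ln (f q)) = fun q => (f q)^-1 * partial i f q.
  by apply/funext => p; apply: partial_ln => //; apply: class_C_derivable _ _ Cf.
apply: class_CM; last exact: class_C_partial.
by apply: class_CV => [p|]; [rewrite gt_eqF|exact: class_CW].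
Qed.

(** The coordinate directions are added one at a time, so the induction runs over the
list of indices, with a partial sum of [v] as the direction. *)
Lemma is_derive_class_C1 f p v : class_C 1 f ->
  is_derive p v f (\sum_(i < m) v 0 i * partial i f p).
Proof.
move=> Cf; rewrite [v in is_derive _ v _ _]row_sum_delta.
elim: (index_enum _) => [|i r IH]; first by rewrite !big_nil; apply: is_derive0.
rewrite !big_cons addrC [X in is_derive _ _ _ X]addrC.
have df q : derivable f q (delta_mx 0 i) by apply: class_C_derivable _ _ Cf.
have ds q := is_derive_scale (v 0 i) (df q).
have E : 'D_(v 0 i *: delta_mx 0 i) f = fun q => v 0 i * partial i f q.
  by apply/funext => q; rewrite (@derive_val _ _ _ _ _ _ _ (ds q)).
rewrite -[v 0 i * _](congr1 (@^~ p) E) -(@derive_val _ _ _ _ _ _ _ IH).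
apply: is_derive_addl; last exact: ex_derive.
- by move=> q; have [] := ds q.
- rewrite E; apply: (@class_C_continuous 0); apply: class_CM.
    exact: class_C_cst.
  exact: class_C_partial.
Qed.

Lemma derive_class_C1 f v : class_C 1 f ->
  'D_v f = fun p => \sum_(i < m) v 0 i * partial i f p.
Proof.
move=> Cf; apply/funext => p.
exact: (@derive_val _ _ _ _ _ _ _ (is_derive_class_C1 p v Cf)).
Qed.

Lemma class_C_derive k f v : class_C k.+1 f -> class_C k ('D_v f).
Proof.
move=> Cf; rewrite derive_class_C1; last by elim: k Cf => // k IH /class_CW.
apply: class_C_sum => i; apply: class_CM; first exact: class_C_cst.
exact: class_C_partial.
Qed.

Lemma partial_sum (I : Type) (r : seq I) (F : I -> 'rV[R]_m -> R) (i : 'I_m) p :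
  (forall a, derivable (F a) p (delta_mx 0 i)) ->
  partial i (fun q => \sum_(a <- r) F a q) p = \sum_(a <- r) partial i (F a) p.
Proof.
move=> dF; suff [] : is_derive p (delta_mx 0 i) (fun q => \sum_(a <- r) F a q)
  (\sum_(a <- r) partial i (F a) p) by [].
elim: r => [|a r IH].
  by under eq_fun do rewrite big_nil; rewrite big_nil; apply: is_derive_cst.
under eq_fun do rewrite big_cons; rewrite big_cons.
by apply: is_deriveD; apply: derivableP.
Qed.

Lemma partial_comm f (i j : 'I_m) p : class_C 2 f ->
  partial i (partial j f) p = partial j (partial i f) p.
Proof.
move=> Cf; apply: derive_comm => [q|q|q|q||];
  try by apply: class_C_derivable; eauto using class_C_partial.
- exact: class_C_continuous (class_C_partial _ (class_C_partial _ Cf)).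
- exact: class_C_continuous (class_C_partial _ (class_C_partial _ Cf)).
Qed.

Lemma derive2_class_C2 f v w p : class_C 2 f ->
  'D_w ('D_v f) p = \sum_(i < m) \sum_(j < m) v 0 i * w 0 j * partial j (partial i f) p.
Proof.
move=> Cf; have C1 := class_CW Cf.
rewrite [LHS](congr1 (@^~ p) (derive_class_C1 w (class_C_derive v Cf))).
rewrite exchange_big /=.
apply: eq_bigr => j _; rewrite (derive_class_C1 v C1) partial_sum; last first.
  move=> i; apply: (@class_C_derivable 0); apply: class_CM; first exact: class_C_cst.
  exact: class_C_partial.
rewrite big_distrr /=; apply: eq_bigr => i _.
rewrite partialM; last 2 first.
- exact: derivable_cst.
- exact: class_C_derivable _ _ (class_C_partial _ Cf).
rewrite [X in _ + X * _](_ : _ = 0); last exact: derive_cst.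
by rewrite mul0r addr0; ring.
Qed.

End FiniteOrderSmoothness.

(** * Derivatives of determinants and inverse matrices *)

Section MatrixCalculus.
Variables (R : realType) (m n : nat).
Implicit Types (F : 'rV[R]_m -> 'M[R]_n) (p : 'rV[R]_m) (i : 'I_m).

Definition partial_mx i F p : 'M[R]_n := \matrix_(a, b) partial i (fun q => F q a b) p.

(** The conditional in each summand is what makes the result, summed over a
permutation, the determinant of a matrix with one row differentiated. *)
Lemma partial_prod (r : nat) (f : 'I_r -> 'rV[R]_m -> R) i p :
  (forall a, derivable (f a) p (delta_mx 0 i)) ->
  partial i (fun q => \prod_(a < r) f a q) p =
  \sum_(a < r) \prod_(b < r) (if b == a then partial i (f b) p else f b p).
Proof.
suff H : (forall a, derivable (f a) p (delta_mx 0 i)) ->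
  is_derive p (delta_mx 0 i) (fun q => \prod_(a < r) f a q)
    (\sum_(a < r) \prod_(b < r) (if b == a then partial i (f b) p else f b p)).
  by move=> /H [].
elim: r f => [|r IH] f df.
  under eq_fun do rewrite big_ord0; rewrite big_ord0; apply: is_derive_cst.
under eq_fun do rewrite big_ord_recl.
have H1 := IH _ (fun a => df (lift ord0 a)).
have H2 : is_derive p (delta_mx 0 i) (f ord0) (partial i (f ord0) p).
  exact: derivableP.
apply: is_derive_eq (is_deriveM H2 H1) _.
rewrite big_ord_recl [RHS]addrC; congr (_ + _).
  rewrite scaler_sumr; apply: eq_bigr => a _ /=.
  by rewrite big_ord_recl.
by rewrite big_ord_recl /= [LHS]mulrC.
Qed.

Lemma class_C_det k F : (forall a b, class_C k (fun q => F q a b)) ->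
  class_C k (fun q => \det (F q)).
Proof.
move=> CF; apply: class_C_sum => s; apply: class_CM; first exact: class_C_cst.
by apply: class_C_prod.
Qed.

(** Jacobi's formula: differentiating the Leibniz expansion gives the sum of the
determinants with one row replaced by its derivative, and expanding each along that
row produces the cofactors of [F p]. *)
Lemma partial_det F i p : (forall a b, derivable (fun q => F q a b) p (delta_mx 0 i)) ->
  partial i (fun q => \det (F q)) p = \tr (partial_mx i F p *m \adj (F p)).
Proof.
move=> dF; rewrite /determinant.
have dP (s : 'I_n -> 'I_n) : derivable (fun q => \prod_(a < n) F q a (s a)) p (delta_mx 0 i).
  elim: (index_enum _) => [|a r IH].
    by under eq_fun do rewrite big_nil; apply: derivable_cst.
  by under eq_fun do rewrite big_cons; apply: derivableM.
rewrite partial_sum; last first.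
  by move=> s; apply: derivableM => //; apply: derivable_cst.
pose M a : 'M[R]_n := \matrix_(b, c) (if b == a then partial_mx i F p b c else F p b c).
transitivity (\sum_a \det (M a)).
  rewrite exchange_big /=; apply: eq_bigr => s _.
  rewrite partialM; [|exact: derivable_cst|exact: dP].
  rewrite [X in _ + X * _]derive_cst mul0r addr0.
  rewrite partial_prod // big_distrr /=; apply: eq_bigr => a _.
  by congr (_ * _); apply: eq_bigr => b _; rewrite !mxE; case: ifP.
apply: eq_bigr => a _; rewrite (expand_det_row _ a) [RHS]mxE.
apply: eq_bigr => b _; rewrite !mxE eqxx; congr (_ * _).
rewrite /cofactor; congr (_ * \det _); apply/matrixP => c d; rewrite !mxE.
by rewrite eq_sym (negbTE (neq_lift _ _)).
Qed.

Lemma partial_ln_det F i p : (forall a b, derivable (fun q => F q a b) p (delta_mx 0 i)) ->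
  0 < \det (F p) ->
  derivable (fun q => \det (F q)) p (delta_mx 0 i) ->
  partial i (fun q => ln (\det (F q))) p = \tr (partial_mx i F p *m invmx (F p)).
Proof.
move=> dF d0 dd; rewrite partial_ln // partial_det // /invmx unitmxE unitfE gt_eqF //.
by rewrite -scalemxAr linearZ.
Qed.

Lemma class_C_invmx k F : (forall p, F p \in unitmx) ->
  (forall a b, class_C k (fun q => F q a b)) ->
  forall a b, class_C k (fun q => invmx (F q) a b).
Proof.
move=> uF CF a b.
have -> : (fun q => invmx (F q) a b) =
  fun q => (\det (F q))^-1 * ((fun=> (-1) ^+ (b + a)) q *
     \det (row' b (col' a (F q)))).
  by apply/funext => q; rewrite /invmx uF !mxE.
apply: class_CM.
  by apply: class_CV; [move=> p; rewrite -unitfE -unitmxE|exact: class_C_det].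
apply: class_CM; first exact: class_C_cst.
apply: class_C_sum => s; apply: class_CM; first exact: class_C_cst.
by apply: class_C_prod => c; under eq_fun do rewrite !mxE.
Qed.

Lemma partial_mulmx F F' i p a b :
  (forall a b, derivable (fun q => F q a b) p (delta_mx 0 i)) ->
  (forall a b, derivable (fun q => F' q a b) p (delta_mx 0 i)) ->
  partial i (fun q => (F q *m F' q) a b) p =
  (partial_mx i F p *m F' p + F p *m partial_mx i F' p) a b.
Proof.
move=> dF dF'; under [fun q => _]eq_fun do rewrite mxE.
rewrite partial_sum; last by move=> c; apply: derivableM.
rewrite !mxE -big_split /=; apply: eq_bigr => c _.
by rewrite partialM // !mxE addrC.
Qed.

(** Obtained by differentiating [invmx F *m F = 1]. *)
Lemma partial_invmx F i p : (forall q, F q \in unitmx) ->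
  (forall a b, class_C 1 (fun q => F q a b)) ->
  partial_mx i (fun q => invmx (F q)) p =
  - (invmx (F p) *m partial_mx i F p *m invmx (F p)).
Proof.
move=> uF CF; have CK := class_C_invmx uF CF.
have E : partial_mx i (fun q => invmx (F q)) p *m F p
       + invmx (F p) *m partial_mx i F p = 0.
  apply/matrixP => a b; rewrite -partial_mulmx; last 2 first.
  - by move=> *; apply: class_C_derivable (CK _ _).
  - by move=> *; apply: class_C_derivable (CF _ _).
  rewrite [RHS]mxE; under [fun q => _]eq_fun do rewrite mulVmx //.
  exact: derive_cst.
by rewrite -mulNmx -(addr0_eq E) opprK mulmxK.
Qed.

End MatrixCalculus.

(** * Positive definite matrices and the volume of a cube *)

Section PositiveDeterminant.
Variable (R : realType).

Lemma mul_tr_gt0 (n : nat) (v : 'rV[R]_n) : v != 0 -> 0 < (v *m v^T) 0 0.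
Proof.
move=> v0; have [j vj] : exists j, v 0 j != 0 by apply/rV0Pn.
rewrite mxE (bigD1 j) //= mxE ltr_pwDl //.
  by rewrite -expr2 exprn_even_gt0.
by apply: sumr_ge0 => k _; rewrite mxE -expr2 sqr_ge0.
Qed.

(** The segment from the identity to [A] consists of positive definite, hence
invertible, matrices, so the polynomial [t |-> det (1 + t (A - 1))] has no root in
[0, 1] and keeps the sign that it has at 0. *)
Lemma det_gt0_posdef (n : nat) (A : 'M[R]_n) :
  (forall v, v != 0 -> 0 < bilin A v v) -> 0 < \det A.
Proof.
move=> pA; pose q : {poly R} := \det (map_mx polyC 1%:M + 'X *: map_mx polyC (A - 1%:M)).
have qE (t : R) : q.[t] = \det (1%:M + t *: (A - 1%:M)).
  rewrite -horner_evalE -det_map_mx; congr (\det _); apply/matrixP => i j.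
  by rewrite !mxE /= horner_evalE !hornerE.
have qn0 (t : R) : 0 <= t <= 1 -> q.[t] != 0.
  move=> /andP[t0 t1]; rewrite qE; apply/det0P => -[v v0 /(congr1 (mulmx^~ v^T))].
  rewrite mul0mx => /matrixP/(_ 0 0); apply/eqP; rewrite [X in _ != X]mxE.
  have -> : 1%:M + t *: (A - 1%:M) = (1 - t) *: 1%:M + t *: A.
    by rewrite scalerBr scalerBl scale1r [RHS]addrAC addrA.
  rewrite mulmxDr mulmxDl -!scalemxAr -!scalemxAl mulmx1.
  rewrite mxE [X in X + _]mxE [X in _ + X]mxE.
  have := pA v v0; have := mul_tr_gt0 v0; rewrite /bilin; set x := (_ *m _) 0 0.
  set y := (_ *m _ *m _) 0 0 => x0 y0.
  move: t0; rewrite le_eqVlt => /predU1P[<-|t0].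
    by rewrite subr0 mul1r mul0r addr0 gt_eqF.
  by rewrite gt_eqF // ltr_wpDl // ?mulr_gt0 // mulr_ge0 ?subr_ge0 // ltW.
have q0 : q.[0] = 1 by rewrite qE scale0r addr0 det1.
have q1 : q.[1] = \det A by rewrite qE scale1r addrC subrK.
rewrite ltNge -q1; apply/negP => q1le.
have : exists2 t, 0 <= t <= 1 & root (- q) t.
  by apply: poly_ivt => //; rewrite !hornerN q0 lerN10 oppr_ge0 q1le.
by move=> [t t01]; rewrite rootN => /rootP/eqP; rewrite (negbTE (qn0 _ t01)).
Qed.

End PositiveDeterminant.

Lemma cube_integral_cst (R : realType) (a b c : R) (n : nat) : a <= b ->
  cube_integral a b (fun _ : 'rV[R]_n => c) = (b - a) ^+ n * c.
Proof.
move=> ab; elim: n => [|n IH] /=; first by rewrite mul1r.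
have vol : fine (@lebesgue_measure R `[a, b]) = b - a.
  rewrite lebesgue_measure_itv /=; move: ab; rewrite le_eqVlt => /predU1P[->|ab'].
    by rewrite ltxx subrr.
  by rewrite lte_fin ab'.
under eq_Rintegral do rewrite IH.
by rewrite Rintegral_cst // [X in _ * X]vol exprS mulrC mulrA.
Qed.

(** * Convexity and second derivatives *)

Section Convexity.
Variables (R : realType) (m : nat).
Implicit Types (f : 'rV[R]_m -> R) (p v x y : 'rV[R]_m).

Lemma convex_on_RnP f : convex_on_Rn f <->
  forall x y (t : R), 0 <= t <= 1 ->
    f (t *: x + (1 - t) *: y) <= t * f x + (1 - t) * f y.
Proof.
split=> [cf x y t /andP[t0 t1]|cf t x y _ _].
  exact: (cf (Itv01 t0 t1) x y (in_setT _) (in_setT _)).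
have := cf x y t%:num; apply.
by rewrite ge0 le1.
Qed.

Lemma class_C_along f p v : class_C 1 f -> derivable f p v.
Proof. by move=> Cf; have [] := is_derive_class_C1 p v Cf. Qed.

Arguments class_C_along [f] p v _.

Lemma derive2N f p v : class_C 2 f ->
  'D_v ('D_v (fun q => - f q)) p = - 'D_v ('D_v f) p.
Proof.
move=> Cf.
have -> : 'D_v (fun q => - f q) = fun q => - 'D_v f q.
  by apply/funext => q; exact: deriveN (class_C_along q v (class_CW Cf)).
exact: deriveN (class_C_along p v (class_C_derive v Cf)).
Qed.

(** The second difference with base point [p] is the defect of convexity at the
midpoint [p + h v] of [p] and [p + 2 h v]. *)
Lemma convex_derive2_ge0 f p v : class_C 2 f -> convex_on_Rn f ->
  0 <= 'D_v ('D_v f) p.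
Proof.
move=> Cf /convex_on_RnP cf.
have C1 := class_C_derive v Cf; have C0 := class_C_derive v C1.
have lim := @second_difference_cvg _ _ f p v v (fun q => class_C_along q v (class_CW Cf))
  (fun q => class_C_along q v C1) (class_C_continuous C0).
apply: (cvgr_to_ge lim); near=> h.
rewrite mulr_ge0 ?invr_ge0 -?expr2 ?sqr_ge0 //.
have := cf p (p + h *: v + h *: v) 2^-1.
have -> : 1 - 2^-1 = 2^-1 :> R by lra.
have -> : 2^-1 *: p + 2^-1 *: (p + h *: v + h *: v) = p + h *: v.
  rewrite !scalerDr !addrA -scalerDl -addrA -scalerDl.
  by have -> : 2^-1 + 2^-1 = 1 :> R; [lra|rewrite !scale1r].
have h01 : 0 <= (2^-1 : R) <= 1 by apply/andP; split; lra.
move=> /(_ h01); lra.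
Unshelve. all: by end_near.
Qed.

(** Reduction to one variable along the segment from [x] to [y]. *)
Lemma derive2_ge0_convex f : class_C 2 f ->
  (forall p v, 0 <= 'D_v ('D_v f) p) -> convex_on_Rn f.
Proof.
move=> Cf pos; apply/convex_on_RnP => x y t /andP[t0 t1].
pose v := y - x; have C1 := class_C_derive v Cf.
pose g (s : R) : R := f (x + s *: v).
have dg (s : R) : is_derive s 1 g ('D_v f (x + s *: v)).
  by apply: derivable_line; apply: class_C_along; apply: class_CW.
have dg1 : 'D_1 g = fun s => 'D_v f (x + s *: v).
  by apply/funext => s; rewrite (@derive_val _ _ _ _ _ _ _ (dg s)).
have ddg (s : R) : is_derive s 1 ('D_1 g) ('D_v ('D_v f) (x + s *: v)).
  by rewrite dg1; apply: derivable_line; apply: class_C_along.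
have cg : continuous g.
  by move=> s; apply/differentiable_continuous/derivable1_diffP; apply: ex_derive.
have key : g (1 - t) <= t * g 0 + (1 - t) * g 1.
  have := @second_derivative_convex R g 0 1 _ _ _ _ _ (Itv01 t0 t1) ler01.
  rewrite !convRE /= mulr0 mulr1 add0r; apply.
  - by move=> s _; rewrite (@derive_val _ _ _ _ _ _ _ (ddg s)).
  - exact: cvg_at_left_filter (cg 1).
  - exact: cvg_at_right_filter (cg 0).
  - by move=> s _; apply: ex_derive.
  - by move=> s _; apply: ex_derive.
move: key; rewrite /g /v scale0r addr0 scale1r subrKC.
suff -> : x + (1 - t) *: (y - x) = t *: x + (1 - t) *: y by [].
by rewrite scalerBr addrCA addrC -{1}[x]scale1r -scalerBl opprB subrKC.
Qed.

Lemma convex_exp f : convex_on_Rn f -> convex_on_Rn (fun x => expR (f x)).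
Proof.
move=> /convex_on_RnP cf; apply/convex_on_RnP => x y t /andP[t0 t1].
apply: (@le_trans _ _ (expR (t * f x + (1 - t) * f y))).
  by rewrite ler_expR cf // t0.
exact: (convex_expR (Itv01 t0 t1) (f x) (f y)).
Qed.

(** The first derivatives have zero derivative along every line, so they are constant;
the mean value theorem between [0] and [x] then gives the affine formula. *)
Lemma derive2_eq0_affine f : class_C 2 f ->
  (forall i j p, partial j (partial i f) p = 0) ->
  forall x, f x = (\row_i partial i f 0 *m x^T) 0 0 + f 0.
Proof.
move=> Cf d0 x.
have cst i p : partial i f p = partial i f 0.
  have C1 := class_C_partial i Cf.
  have [s _] := mean_value_along 0 1 (fun q => class_C_along q p C1).
  rewrite add0r scale1r (congr1 (@^~ _) (derive_class_C1 p C1)) big1 ?mulr0.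
    by move/subr0_eq.
  by move=> j _; rewrite d0 mulr0.
have C1 := class_CW Cf.
have [s _] := mean_value_along 0 1 (fun q => class_C_along q x C1).
rewrite add0r scale1r mul1r (congr1 (@^~ _) (derive_class_C1 x C1)) => /eqP.
rewrite subr_eq => /eqP ->; congr (_ + _).
by rewrite mxE; apply: eq_bigr => i _; rewrite !mxE cst mulrC.
Qed.

End Convexity.

(** * Functions invariant under the torus action *)

Section TorusInvariant.
Variables (R : realType) (n : nat).
Implicit Types (p : 'rV[R]_(n + n)).

Definition torus_invariant (T : Type) (f : 'rV[R]_(n + n) -> T) :=
  forall p (theta : 'rV[R]_n), f (p + row_mx 0 theta) = f p.

(** The difference quotients at the two points agree. *)
Lemma derive_torus_invariant (f : 'rV[R]_(n + n) -> R) v :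
  torus_invariant f -> torus_invariant ('D_v f).
Proof.
move=> inv p theta; rewrite /derive; set F := (fun h : R => _); set F' := (fun h : R => _).
by have -> : F = F' by apply/funext => h; rewrite /F /F' /= inv addrA inv.
Qed.

Lemma derive_vertical (f : 'rV[R]_(n + n) -> R) theta p :
  torus_invariant f -> 'D_(row_mx 0 theta) f p = 0.
Proof.
move=> inv; rewrite /derive; apply/lim_near_cst => //; near=> h => /=.
by rewrite scale_row_mx scaler0 [_ + p]addrC inv subrr scaler0.
Unshelve. all: by end_near.
Qed.

Lemma delta_rshift (i : 'I_n) :
  delta_mx 0 (rshift n i) = row_mx 0 (delta_mx 0 i) :> 'rV[R]_(n + n)%N.
Proof.
apply/rowP => j; rewrite !mxE; case: split_ordP => k ->; rewrite !mxE eqxx /=.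
  by rewrite eq_lrshift.
by rewrite eq_rshift.
Qed.

Lemma delta_lshift (i : 'I_n) :
  delta_mx 0 (lshift n i) = row_mx (delta_mx 0 i) 0 :> 'rV[R]_(n + n)%N.
Proof.
apply/rowP => j; rewrite !mxE; case: split_ordP => k ->; rewrite !mxE eqxx /=.
  by rewrite eq_lshift.
by rewrite eq_rlshift.
Qed.

Lemma delta_lshift_cplxJ (i : 'I_n) :
  (delta_mx 0 (lshift n i) : 'rV[R]_(n + n)) *m cplxJ R n = delta_mx 0 (rshift n i).
Proof.
rewrite delta_lshift delta_rshift /cplxJ mul_row_block.
by rewrite !mul0mx mulmx0 mulmx1 !addr0.
Qed.

Lemma delta_rshift_cplxJ (i : 'I_n) :
  (delta_mx 0 (rshift n i) : 'rV[R]_(n + n)) *m cplxJ R n = - delta_mx 0 (lshift n i).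
Proof.
rewrite delta_lshift delta_rshift /cplxJ mul_row_block.
by rewrite !mul0mx mulmx0 mulmxN mulmx1 !add0r opp_row_mx oppr0.
Qed.

Lemma bilin_delta m (A : 'M[R]_m) i j : bilin A (delta_mx 0 i) (delta_mx 0 j) = A i j.
Proof. by rewrite /bilin trmx_delta -rowE -colE !mxE. Qed.

End TorusInvariant.

(** * Block form of the metric *)

Section HamiltonianKahler.
Variables (R : realType) (n : nat) (G : 'rV[R]_(n + n) -> 'M[R]_(n + n)).
Hypotheses (hK : kahler_metric G) (hH : hamiltonian_torus_action G).
Implicit Types (p : 'rV[R]_(n + n)) (i j k : 'I_n).

Lemma metric_smooth a b : smooth (fun p => G p a b).
Proof. by case: hK => _ [sG _ _] _ _; apply: sG. Qed.

Lemma metric_sym p a b : G p a b = G p b a.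
Proof. by case: hK => _ [_ sG _] _ _; rewrite -[in LHS](sG p) mxE. Qed.

Lemma kahler_form_lshift p j b : kahler_form G p (lshift n j) b = G p (rshift n j) b.
Proof.
by rewrite -bilin_delta /bilin mulmxA delta_lshift_cplxJ -/(bilin _ _ _) bilin_delta.
Qed.

Lemma kahler_form_rshift p j b : kahler_form G p (rshift n j) b = - G p (lshift n j) b.
Proof.
rewrite -bilin_delta /bilin mulmxA delta_rshift_cplxJ !mulNmx mxE.
by rewrite -/(bilin _ _ _) bilin_delta.
Qed.

(** Since J maps d/dy_j to - d/dx_j, the moment map equation for the j-th rotation
says that the j-th row of the metric is minus the gradient of [mu_j]. *)
Lemma moment_map_row : exists mu : 'rV[R]_(n + n) -> 'rV[R]_n,
  torus_invariant mu /\
  forall p j b, 'D_(delta_mx 0 b) (fun q => mu q 0 j) p = - G p (lshift n j) b.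
Proof.
case: hH => mu [_ inv dmu]; exists mu; split=> // p j b.
rewrite -kahler_form_rshift -bilin_delta delta_rshift -dmu.
congr ('D_ _ _ p); apply/funext => q.
by rewrite trmx_delta -colE mxE.
Qed.

(** The derivative of [mu_j] in the direction of the orbits vanishes. *)
Lemma metric_lr p j k : G p (lshift n j) (rshift n k) = 0.
Proof.
have [mu [inv dmu]] := moment_map_row.
apply: oppr_inj; rewrite -dmu delta_rshift oppr0; apply: derive_vertical.
by move=> q theta; rewrite inv.
Qed.

Lemma metric_rl p j k : G p (rshift n j) (lshift n k) = 0.
Proof. by rewrite metric_sym metric_lr. Qed.

(** J is an isometry and maps d/dx_j to d/dy_j. *)
Lemma metric_rr p j k : G p (rshift n j) (rshift n k) = G p (lshift n j) (lshift n k).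
Proof.
case: hK => _ _ hJ _.
by rewrite -!bilin_delta -!delta_lshift_cplxJ hJ.
Qed.

Lemma metric_invariant a b : torus_invariant (fun p => G p a b).
Proof.
suff inv j k : torus_invariant (fun p => G p (lshift n j) (lshift n k)).
  move=> p theta; case: (split_ordP a) => j ->; case: (split_ordP b) => k ->.
  - exact: inv.
  - by rewrite !metric_lr.
  - by rewrite !metric_rl.
  - by rewrite !metric_rr; apply: inv.
have [mu [inv dmu]] := moment_map_row.
move=> p theta; apply: oppr_inj; rewrite -!dmu.
by apply: derive_torus_invariant => q theta'; rewrite inv.
Qed.

Definition base_metric p : 'M[R]_n := ulsubmx (G p).

Local Notation H := base_metric.

Lemma metric_block p : G p = block_mx (H p) 0 0 (H p).
Proof.
rewrite -[LHS]submxK; congr block_mx; apply/matrixP => i j; rewrite !mxE.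
- exact: metric_lr.
- exact: metric_rl.
- exact: metric_rr.
Qed.

Lemma base_metric_det_gt0 p : 0 < \det (H p).
Proof.
apply: det_gt0_posdef => v v0; case: hK => _ [_ _ pG] _ _.
have := pG p (row_mx v 0); rewrite metric_block /bilin mul_row_block.
rewrite !mul0mx mulmx0 !addr0 tr_row_mx mul_row_col trmx0 mulmx0 addr0; apply.
by apply: contra_neq v0 => /(congr1 lsubmx); rewrite row_mxKl linear0.
Qed.

Lemma base_metric_unit p : H p \in unitmx.
Proof. by rewrite unitmxE unitfE gt_eqF ?base_metric_det_gt0. Qed.

Lemma base_metric_class_C m i j : class_C m (fun p => H p i j).
Proof. by under eq_fun do rewrite !mxE; apply/smooth_class_C/metric_smooth. Qed.

Lemma base_metric_invariant : torus_invariant H.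
Proof. by move=> p theta; apply/matrixP => i j; rewrite !mxE; apply: metric_invariant. Qed.

Definition dmetric i j k p : R := partial (lshift n i) (fun q => H q j k) p.

Local Notation dH := dmetric.

Lemma partial_rshift i (f : 'rV[R]_(n + n) -> R) p :
  torus_invariant f -> partial (rshift n i) f p = 0.
Proof. by move=> inv; rewrite /partial delta_rshift; apply: derive_vertical. Qed.

Lemma partial_metric_r i a b p : partial (rshift n i) (fun q => G q a b) p = 0.
Proof. exact/partial_rshift/metric_invariant. Qed.

Lemma partial_metric_ll i j k p :
  partial (lshift n i) (fun q => G q (lshift n j) (lshift n k)) p = dH i j k p.
Proof. by rewrite /dH; under [in RHS]eq_fun do rewrite !mxE. Qed.

Lemma partial_metric_rr i j k p :
  partial (lshift n i) (fun q => G q (rshift n j) (rshift n k)) p = dH i j k p.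
Proof. by rewrite -partial_metric_ll; under eq_fun do rewrite metric_rr. Qed.

Lemma partial_metric_lr I j k p :
  partial I (fun q => G q (lshift n j) (rshift n k)) p = 0.
Proof. by under eq_fun do rewrite metric_lr; apply: derive_cst. Qed.

Lemma partial_metric_rl I j k p :
  partial I (fun q => G q (rshift n j) (lshift n k)) p = 0.
Proof. by under eq_fun do rewrite metric_rl; apply: derive_cst. Qed.

Definition partial_metricE := (partial_metric_r, partial_metric_ll,
  partial_metric_rr, partial_metric_lr, partial_metric_rl).

Lemma dmetric_sym i j k p : dH i j k p = dH i k j p.
Proof.
rewrite -!partial_metric_ll; congr (partial _ _ p); apply/funext => q.
exact: metric_sym.
Qed.

(** Closedness of the Kaehler form on (d/dx_i, d/dx_j, d/dy_k), whose matrix has H in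
the off-diagonal blocks. With [dmetric_sym] it makes [dH] totally symmetric. *)
Lemma dmetric_closed i j k p : dH i j k p = dH j i k p.
Proof.
case: hK => _ _ _ /(_ p (lshift n i) (lshift n j) (rshift n k)).
under [X in partial _ X]eq_fun do rewrite kahler_form_lshift.
under [X in _ + partial _ X _ + _]eq_fun do rewrite kahler_form_rshift.
under [X in _ + _ + partial _ X _]eq_fun do rewrite kahler_form_lshift.
rewrite partial_metric_rr partial_metric_rl addr0 /partial deriveN; last first.
  exact: class_C_derivable _ _ (smooth_class_C 1 (metric_smooth _ _)).
rewrite -/(partial (lshift n j) (fun q => G q (lshift n k) (lshift n i)) p).
by rewrite partial_metric_ll (dmetric_sym j) => /subr0_eq.
Qed.

Lemma dmetric_class_C m i j k : class_C m (dH i j k).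
Proof. exact: class_C_partial (base_metric_class_C _ _ _). Qed.

Lemma dmetric_invariant i j k : torus_invariant (dH i j k).
Proof.
by apply: derive_torus_invariant => p theta; rewrite base_metric_invariant.
Qed.

Opaque derive.

(** * Christoffel symbols *)

Local Notation K p := (invmx (H p)).

Lemma inv_metric p : invmx (G p) = block_mx (K p) 0 0 (K p).
Proof.
rewrite metric_block invmx_block_diag //.
by rewrite unitmxE det_ublock unitrM -!unitmxE base_metric_unit.
Qed.

Lemma inv_metric_ll p i j : invmx (G p) (lshift n i) (lshift n j) = K p i j.
Proof. by rewrite inv_metric block_mxEul. Qed.

Lemma inv_metric_rr p i j : invmx (G p) (rshift n i) (rshift n j) = K p i j.
Proof. by rewrite inv_metric block_mxEdr. Qed.

Lemma inv_metric_lr p i j : invmx (G p) (lshift n i) (rshift n j) = 0.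
Proof. by rewrite inv_metric block_mxEur mxE. Qed.

Lemma inv_metric_rl p i j : invmx (G p) (rshift n i) (lshift n j) = 0.
Proof. by rewrite inv_metric block_mxEdl mxE. Qed.

Definition inv_metricE := (inv_metric_ll, inv_metric_rr, inv_metric_lr, inv_metric_rl).

(** The Christoffel symbols of H: the three terms of the Koszul formula are equal
because [dH] is totally symmetric, so two cancel. *)
Definition base_christoffel k i j p : R := 2^-1 * \sum_l K p k l * dH i j l p.

Local Notation Gam := base_christoffel.

Lemma base_christoffel_class_C m k i j : class_C m (Gam k i j).
Proof.
apply: class_CM; first exact: class_C_cst.
apply: class_C_sum => l; apply: class_CM; last exact: dmetric_class_C.
apply: class_C_invmx; first exact: base_metric_unit.
by move=> *; apply: base_metric_class_C.
Qed.

Lemma base_christoffel_invariant k i j : torus_invariant (Gam k i j).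
Proof.
move=> p theta; congr (_ * _); apply: eq_bigr => l _.
by rewrite dmetric_invariant base_metric_invariant.
Qed.

(** Of the eight types of symbols, those with an odd number of y-indices vanish; the
others are [Gam] up to sign, which is negative only when both lower indices are
y-indices, where only the term - d_l g_ij of the Koszul formula survives. *)
Lemma christoffel_lll k i j p :
  christoffel G (lshift n k) (lshift n i) (lshift n j) p = Gam k i j p.
Proof.
rewrite /christoffel big_split_ord /= [X in _ + X]big1 ?addr0; last first.
  by move=> l _; rewrite inv_metricE mul0r.
congr (_ * _); apply: eq_bigr => l _; rewrite inv_metricE !partial_metricE.
by rewrite (dmetric_closed j) (dmetric_closed l) (dmetric_sym i l) addrK.
Qed.

Lemma christoffel_lrr k i j p :
  christoffel G (lshift n k) (rshift n i) (rshift n j) p = - Gam k i j p.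
Proof.
rewrite /christoffel big_split_ord /= [X in _ + X]big1 ?addr0; last first.
  by move=> l _; rewrite inv_metricE mul0r.
rewrite -mulrN -sumrN; congr (_ * _); apply: eq_bigr => l _.
rewrite inv_metricE !partial_metricE.
by rewrite (dmetric_closed l) (dmetric_sym i l) addr0 add0r mulrN.
Qed.

Lemma christoffel_rlr k i j p :
  christoffel G (rshift n k) (lshift n i) (rshift n j) p = Gam k i j p.
Proof.
rewrite /christoffel big_split_ord /= [X in X + _]big1 ?add0r; last first.
  by move=> l _; rewrite inv_metricE mul0r.
congr (_ * _); apply: eq_bigr => l _.
by rewrite inv_metricE !partial_metricE subr0 addr0.
Qed.

Lemma christoffel_rrl k i j p :
  christoffel G (rshift n k) (rshift n i) (lshift n j) p = Gam k i j p.
Proof.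
rewrite /christoffel big_split_ord /= [X in X + _]big1 ?add0r; last first.
  by move=> l _; rewrite inv_metricE mul0r.
congr (_ * _); apply: eq_bigr => l _.
by rewrite inv_metricE !partial_metricE subr0 add0r dmetric_closed.
Qed.

Lemma christoffel_llr k i j p :
  christoffel G (lshift n k) (lshift n i) (rshift n j) p = 0.
Proof.
rewrite /christoffel big1 ?mulr0 // => a _; case: (split_ordP a) => l ->.
  by rewrite !partial_metricE subr0 addr0 mulr0.
by rewrite inv_metricE mul0r.
Qed.

Lemma christoffel_lrl k i j p :
  christoffel G (lshift n k) (rshift n i) (lshift n j) p = 0.
Proof.
rewrite /christoffel big1 ?mulr0 // => a _; case: (split_ordP a) => l ->.
  by rewrite !partial_metricE subr0 addr0 mulr0.
by rewrite inv_metricE mul0r.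
Qed.

Lemma christoffel_rll k i j p :
  christoffel G (rshift n k) (lshift n i) (lshift n j) p = 0.
Proof.
rewrite /christoffel big1 ?mulr0 // => a _; case: (split_ordP a) => l ->.
  by rewrite inv_metricE mul0r.
by rewrite !partial_metricE subr0 addr0 mulr0.
Qed.

Lemma christoffel_rrr k i j p :
  christoffel G (rshift n k) (rshift n i) (rshift n j) p = 0.
Proof.
rewrite /christoffel big1 ?mulr0 // => a _; case: (split_ordP a) => l ->.
  by rewrite inv_metricE mul0r.
by rewrite !partial_metricE subr0 addr0 mulr0.
Qed.

Definition christoffelE := (christoffel_lll, christoffel_lrr, christoffel_rlr,
  christoffel_rrl, christoffel_llr, christoffel_lrl, christoffel_rll, christoffel_rrr).

Lemma eq_partial_christoffel a b c d p (f : 'rV[R]_(n + n) -> R) :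
  (forall q, christoffel G b c d q = f q) ->
  partial a (christoffel G b c d) p = partial a f p.
Proof. by move=> E; congr (partial _ _ p); apply/funext. Qed.

(** * Ricci curvature *)

(** In the end - Ric on each diagonal block. *)
Definition dtrace_christoffel j k p : R := \sum_i partial (lshift n j) (Gam i i k) p.

Local Notation E := dtrace_christoffel.

(** The derivative of the inverse matrix produces the product of two symbols [Gam],
and the coefficient 2 comes from the two factors 1/2 in them. *)
Lemma base_christoffel_derive m k i j p :
  partial (lshift n m) (Gam k i j) p =
  - (2 * \sum_q Gam k m q p * Gam q i j p)
  + 2^-1 * \sum_l K p k l * partial (lshift n m) (dH i j l) p.
Proof.
have CK a b := class_C_invmx base_metric_unit (base_metric_class_C 1) a b.
have dK a b : derivable (fun q => K q a b) p (delta_mx 0 (lshift n m)).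
  exact: class_C_derivable (CK a b).
have dt a b c : derivable (dH a b c) p (delta_mx 0 (lshift n m)).
  exact: class_C_derivable (dmetric_class_C 1 a b c).
have dKt l : derivable (fun q => K q k l * dH i j l q) p (delta_mx 0 (lshift n m)).
  exact: derivableM.
rewrite /Gam partialM; [|exact: derivable_cst|].
  2: exact: class_C_derivable (class_C_sum _ (fun l => class_CM (CK k l) (dmetric_class_C 1 i j l))).
rewrite [X in _ + X * _]derive_cst mul0r addr0 partial_sum //.
under eq_bigr => l _ do rewrite partialM // addrC.
rewrite big_split mulrDr; congr (_ + _).
have dKE a b : partial (lshift n m) (fun q => K q a b) p =
    - \sum_q (\sum_r K p a r * dH m q r p) * K p q b.
  have := partial_invmx (lshift n m) p base_metric_unit (base_metric_class_C 1).
  move=> /matrixP/(_ a b); rewrite mxE => ->; rewrite !mxE; congr (- _).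
  apply: eq_bigr => q _; congr (_ * _); rewrite !mxE; apply: eq_bigr => r _.
  by rewrite !mxE -/(dH m r q p) dmetric_sym.
under eq_bigr => l _ do rewrite dKE mulNr mulr_suml.
rewrite sumrN mulrN exchange_big /=; congr (- _).
rewrite !mulr_sumr; apply: eq_bigr => q _.
under eq_bigr => l _ do rewrite -mulrA.
by rewrite -mulr_sumr; field.
Qed.

Definition log_det p : R := ln (\det (H p)).

Local Notation L := log_det.

Lemma log_det_class_C m : class_C m L.
Proof.
apply: class_C_ln; first exact: base_metric_det_gt0.
by apply: class_C_det => *; apply: base_metric_class_C.
Qed.

Lemma log_det_invariant : torus_invariant L.
Proof. by move=> p theta; rewrite /L base_metric_invariant. Qed.

(** Jacobi's formula for log det, after the total symmetry of the derivatives of H has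
moved the free index to the position of the derivation. *)
Lemma base_christoffel_trace k p :
  \sum_i Gam i i k p = 2^-1 * partial (lshift n k) L p.
Proof.
have dH a b : derivable (fun q => H q a b) p (delta_mx 0 (lshift n k)).
  exact: class_C_derivable (base_metric_class_C 1 a b).
have dD : derivable (fun q => \det (H q)) p (delta_mx 0 (lshift n k)).
  apply: class_C_derivable; apply: (@class_C_det _ _ _ 1) => *.
  exact: base_metric_class_C.
rewrite [X in _ = _ * X](partial_ln_det dH (base_metric_det_gt0 p) dD).
rewrite -mulr_sumr; apply: (congr1 (fun z => _ * z)).
rewrite exchange_big; apply: eq_bigr => a _ /=; rewrite mxE.
apply: eq_bigr => b _; rewrite mxE mulrC; apply: (congr1 (fun z => z * _)).
exact: etrans (dmetric_closed _ _ _ _) (dmetric_sym _ _ _ _).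
Qed.

Lemma dtrace_christoffelE j k p :
  E j k p = 2^-1 * partial (lshift n j) (partial (lshift n k) L) p.
Proof.
have Ck := class_C_partial (lshift n k) (log_det_class_C 2).
rewrite /E -partial_sum; last first.
  by move=> i; apply: class_C_derivable (base_christoffel_class_C 1 i i k).
under eq_fun do rewrite base_christoffel_trace.
rewrite partialM; [|exact: derivable_cst|exact: class_C_derivable Ck].
by rewrite [X in _ + X * _]derive_cst mul0r addr0.
Qed.

(** Equality of mixed second derivatives of [H k l]. *)
Lemma dmetric_partial_comm i j k l p :
  partial (lshift n i) (dH j k l) p = partial (lshift n j) (dH i k l) p.
Proof. exact: partial_comm (base_metric_class_C 2 k l). Qed.

Opaque base_christoffel dmetric.

(** By [base_christoffel_derive] both sides equal
[1/2 sum_il H^il d_i d_j H_kl], the left one with the order of the two derivations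
exchanged. *)
Lemma ricci_cancellation j k p :
  \sum_i partial (lshift n i) (Gam i j k) p + 2 * (\sum_i \sum_a Gam i i a p * Gam a j k p)
  = E j k p + 2 * (\sum_i \sum_a Gam i j a p * Gam a i k p).
Proof.
have algebra (a b c d e : R) :
  d = - (2 * a) + c -> e = - (2 * b) + c -> d + 2 * a = e + 2 * b.
  by move=> -> ->; ring.
(* One formula for the divergence (m i = i) and the derivative of the trace (m i = j). *)
have sum_derive (m k' i' j' : 'I_n -> 'I_n) :
  \sum_i partial (lshift n (m i)) (Gam (k' i) (i' i) (j' i)) p =
  - (2 * \sum_i \sum_a Gam (k' i) (m i) a p * Gam a (i' i) (j' i) p)
  + \sum_i 2^-1 * \sum_l K p (k' i) l * partial (lshift n (m i)) (dH (i' i) (j' i) l) p.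
  rewrite mulr_sumr -sumrN -big_split; apply: eq_bigr => i _.
  exact: base_christoffel_derive.
have s1 := sum_derive (fun i => i) (fun i => i) (fun=> j) (fun=> k).
have s2 := sum_derive (fun=> j) (fun i => i) (fun i => i) (fun=> k).
cbv beta in s1, s2; apply: (algebra _ _ _ _ _ s1); rewrite /E; apply: etrans s2 _.
apply: (congr1 (fun z => _ + z)); apply: eq_bigr => i _.
apply: (congr1 (fun z => _ * z)); apply: eq_bigr => l _.
apply: (congr1 (fun z => _ * z)).
exact: dmetric_partial_comm.
Qed.

Lemma christoffel_invariant a b c : torus_invariant (christoffel G a b c).
Proof.
have invS k i j := base_christoffel_invariant k i j.
move=> p theta; case: (split_ordP a) => k ->.
  case: (split_ordP b) => i ->; case: (split_ordP c) => j ->.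
  - by rewrite !christoffel_lll invS.
  - by rewrite !christoffel_llr.
  - by rewrite !christoffel_lrl.
  - by rewrite !christoffel_lrr invS.
case: (split_ordP b) => i ->; case: (split_ordP c) => j ->.
- by rewrite !christoffel_rll.
- by rewrite !christoffel_rlr invS.
- by rewrite !christoffel_rrl invS.
- by rewrite !christoffel_rrr.
Qed.

Lemma partial_christoffel_eq0 a b c d p : (forall q, christoffel G b c d q = 0) ->
  partial a (christoffel G b c d) p = 0.
Proof. by move=> E0; rewrite (eq_partial_christoffel _ _ E0); apply: derive_cst. Qed.

(** The four kinds of summands of the diagonal blocks of the Ricci tensor. Derivatives
in y-directions vanish, and the two lower y-indices of a symbol carry the sign that
turns the xx-block into the yy-block. *)
Lemma riemann_llll i j k p :
  riemann G (lshift n i) (lshift n j) (lshift n k) (lshift n i) p =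
  partial (lshift n i) (Gam i j k) p - partial (lshift n j) (Gam i i k) p
  + \sum_a (Gam i i a p * Gam a j k p - Gam i j a p * Gam a i k p).
Proof.
rewrite /riemann big_split_ord /= [X in _ + (_ + X)]big1; last first.
  by move=> a _; rewrite !christoffelE !(mul0r, mulr0) subrr.
rewrite addr0 (eq_partial_christoffel _ _ (christoffel_lll i j k)).
rewrite (eq_partial_christoffel _ _ (christoffel_lll i i k)).
apply: (congr1 (fun z => _ + z)); apply: eq_bigr => a _.
by rewrite !christoffelE.
Qed.

Lemma riemann_rllr i j k p :
  riemann G (rshift n i) (lshift n j) (lshift n k) (rshift n i) p =
  - partial (lshift n j) (Gam i i k) p
  + \sum_a (Gam i i a p * Gam a j k p - Gam i j a p * Gam a i k p).
Proof.
rewrite /riemann (partial_rshift _ _ (christoffel_invariant _ _ _)) add0r.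
rewrite (eq_partial_christoffel _ _ (christoffel_rrl i i k)).
apply: (congr1 (fun z => _ + z)); rewrite big_split_ord /= -big_split /=.
apply: eq_bigr => a _; rewrite !christoffelE.
by rewrite !(mul0r, mulr0) subr0 sub0r.
Qed.

Lemma riemann_lrrl i j k p :
  riemann G (lshift n i) (rshift n j) (rshift n k) (lshift n i) p =
  - partial (lshift n i) (Gam i j k) p
  - \sum_a (Gam i i a p * Gam a j k p - Gam i j a p * Gam a i k p).
Proof.
rewrite /riemann (partial_rshift _ _ (christoffel_invariant _ _ _)) subr0.
have -> : partial (lshift n i) (christoffel G (lshift n i) (rshift n j) (rshift n k)) p
    = - partial (lshift n i) (Gam i j k) p.
  rewrite (eq_partial_christoffel _ _ (christoffel_lrr i j k)).
  exact/deriveN/class_C_derivable/(base_christoffel_class_C 1).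
apply: (congr1 (fun z => _ + z)); rewrite big_split_ord /= -big_split -sumrN /=.
apply: eq_bigr => a _; rewrite !christoffelE.
set x := Gam i i a p; set y := Gam a j k p; set z := Gam i j a p; set w := Gam a i k p.
by move: x y z w => x y z w; ring.
Qed.

Lemma riemann_rrrr i j k p :
  riemann G (rshift n i) (rshift n j) (rshift n k) (rshift n i) p =
  - \sum_a (Gam i i a p * Gam a j k p - Gam i j a p * Gam a i k p).
Proof.
rewrite /riemann !(partial_rshift _ _ (christoffel_invariant _ _ _)) subr0 add0r.
rewrite big_split_ord /= -big_split -sumrN /=.
apply: eq_bigr => a _; rewrite !christoffelE.
set x := Gam i i a p; set y := Gam a j k p; set z := Gam i j a p; set w := Gam a i k p.
by move: x y z w => x y z w; ring.
Qed.

Lemma sum_quadratic_split j k p :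
  \sum_i \sum_a (Gam i i a p * Gam a j k p - Gam i j a p * Gam a i k p) =
  \sum_i \sum_a Gam i i a p * Gam a j k p - \sum_i \sum_a Gam i j a p * Gam a i k p.
Proof. by rewrite -sumrB; apply: eq_bigr => i _; rewrite sumrB. Qed.

(** Summing the two kinds of terms gives [D - 2 E + 2 (A - B)] with the divergence [D]
and the quadratic sums [A], [B]; by [ricci_cancellation] it equals [- E]. *)
Lemma ricci_ll j k p : ricci G p (lshift n j) (lshift n k) = - E j k p.
Proof.
have algebra (d e a b c : R) : d + 2 * a = e + 2 * b -> c = a - b ->
  d - e + c + (- e + c) = - e by lra.
apply: etrans _ (algebra _ _ _ _ _ (ricci_cancellation j k p) (sum_quadratic_split j k p)).
rewrite mxE big_split_ord /=; apply: (congr2 +%R).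
  rewrite /E -sumrB -big_split; apply: eq_bigr => i _; exact: riemann_llll.
rewrite /E -sumrN -big_split; apply: eq_bigr => i _; exact: riemann_rllr.
Qed.

Lemma ricci_rr j k p : ricci G p (rshift n j) (rshift n k) = - E j k p.
Proof.
have algebra (d e a b c : R) : d + 2 * a = e + 2 * b -> c = a - b ->
  - d - c + - c = - e by lra.
apply: etrans _ (algebra _ _ _ _ _ (ricci_cancellation j k p) (sum_quadratic_split j k p)).
rewrite mxE big_split_ord /=; apply: (congr2 +%R).
  rewrite -!sumrN -big_split; apply: eq_bigr => i _; exact: riemann_lrrl.
rewrite -sumrN; apply: eq_bigr => i _; exact: riemann_rrrr.
Qed.

Let mulr0_sub (x y : R) : x * 0 - y * 0 = 0.
Proof. by rewrite !mulr0 subrr. Qed.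

Let mul0r_sub (x y : R) : 0 * x - 0 * y = 0.
Proof. by rewrite !mul0r subrr. Qed.

Lemma ricci_lr j k p : ricci G p (lshift n j) (rshift n k) = 0.
Proof.
rewrite mxE big1 // => a _; case: (split_ordP a) => i ->; rewrite /riemann.
  rewrite (partial_christoffel_eq0 _ _ (christoffel_llr i j k)).
  rewrite (partial_christoffel_eq0 _ _ (christoffel_llr i i k)) subrr add0r.
  apply: big1 => b _; case: (split_ordP b) => l ->; rewrite !christoffelE.
    exact: mulr0_sub.
  exact: mul0r_sub.
rewrite (partial_rshift _ _ (christoffel_invariant _ _ _)).
rewrite (partial_christoffel_eq0 _ _ (christoffel_rrr i i k)) subrr add0r.
apply: big1 => b _; case: (split_ordP b) => l ->; rewrite !christoffelE.
  by rewrite mulr0 mul0r subrr.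
by rewrite mul0r mulr0 subrr.
Qed.

Lemma ricci_rl j k p : ricci G p (rshift n j) (lshift n k) = 0.
Proof.
rewrite mxE big1 // => a _; case: (split_ordP a) => i ->; rewrite /riemann.
  rewrite (partial_rshift _ _ (christoffel_invariant _ _ _)).
  rewrite (partial_christoffel_eq0 _ _ (christoffel_lrl i j k)) subrr add0r.
  apply: big1 => b _; case: (split_ordP b) => l ->; rewrite !christoffelE.
    by rewrite mulr0 mul0r subrr.
  by rewrite mul0r mulr0 subrr.
rewrite !(partial_rshift _ _ (christoffel_invariant _ _ _)) subrr add0r.
apply: big1 => b _; case: (split_ordP b) => l ->; rewrite !christoffelE.
  exact: mulr0_sub.
exact: mul0r_sub.
Qed.

Definition ricci_form p (a : 'rV[R]_n) : R :=
  \sum_k (\sum_j a 0 j * E j k p) * a 0 k.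

Lemma bilin_ricci p v :
  bilin (ricci G p) v v = - (ricci_form p (lsubmx v) + ricci_form p (rsubmx v)).
Proof.
rewrite /bilin mxE big_split_ord /= opprD -!sumrN; apply: (congr2 +%R).
  apply: eq_bigr => k _; rewrite !mxE big_split_ord /= -mulNr -sumrN.
  rewrite [X in _ + X]big1 ?addr0; last by move=> j _; rewrite ricci_rl mulr0.
  apply: (congr1 (fun z => z * _)); apply: eq_bigr => j _.
  by rewrite ricci_ll mulrN !mxE.
apply: eq_bigr => k _; rewrite !mxE big_split_ord /= -mulNr -sumrN.
rewrite [X in X + _]big1 ?add0r; last by move=> j _; rewrite ricci_lr mulr0.
apply: (congr1 (fun z => z * _)); apply: eq_bigr => j _.
by rewrite ricci_rr mulrN !mxE.
Qed.

Lemma partial_log_det_r i : partial (rshift n i) L = fun=> 0.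
Proof. by apply/funext => p; apply/partial_rshift/log_det_invariant. Qed.

Lemma partial2_log_det_rl i j p :
  partial (rshift n j) (partial (lshift n i) L) p = 0.
Proof. exact/partial_rshift/derive_torus_invariant/log_det_invariant. Qed.

Lemma hessian_log_det p v : 'D_v ('D_v L) p = 2 * ricci_form p (lsubmx v).
Proof.
rewrite (derive2_class_C2 _ _ _ (log_det_class_C 2)) big_split_ord /=.
rewrite [X in _ + X]big1 ?addr0; last first.
  move=> i _; rewrite big1 // => a _.
  by rewrite partial_log_det_r [X in _ * X]derive_cst mulr0.
rewrite mulr_sumr; apply: eq_bigr => k _; rewrite big_split_ord /=.
rewrite [X in _ + X]big1 ?addr0; last first.
  by move=> j _; rewrite partial2_log_det_rl mulr0.
rewrite mulr_suml mulr_sumr; apply: eq_bigr => j _.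
by rewrite dtrace_christoffelE !mxE; field.
Qed.

(** A vector with equal x- and y-parts isolates one copy of the Hessian of log det H;
conversely Ric on (a, b) is minus half the sum of the Hessians on a and b. *)
Lemma ricci_nonposP : ricci_nonpos G <-> forall p v, 0 <= 'D_v ('D_v L) p.
Proof.
split=> [ric p v|hess p v].
  have := ric p (row_mx (lsubmx v) (lsubmx v)).
  rewrite hessian_log_det bilin_ricci row_mxKl row_mxKr.
  by move: (ricci_form p _) => q; lra.
have := hess p (row_mx (lsubmx v) 0); rewrite hessian_log_det row_mxKl.
have := hess p (row_mx (rsubmx v) 0); rewrite hessian_log_det row_mxKl bilin_ricci.
by move: (ricci_form p (lsubmx v)) (ricci_form p (rsubmx v)) => q q'; lra.
Qed.

Lemma ricci_nonnegP : ricci_nonneg G <-> forall p v, 'D_v ('D_v L) p <= 0.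
Proof.
split=> [ric p v|hess p v].
  have := ric p (row_mx (lsubmx v) (lsubmx v)).
  rewrite hessian_log_det bilin_ricci row_mxKl row_mxKr.
  by move: (ricci_form p _) => q; lra.
have := hess p (row_mx (lsubmx v) 0); rewrite hessian_log_det row_mxKl.
have := hess p (row_mx (rsubmx v) 0); rewrite hessian_log_det row_mxKl bilin_ricci.
by move: (ricci_form p (lsubmx v)) (ricci_form p (rsubmx v)) => q q'; lra.
Qed.

Lemma ricci_flat_partial2 I J p : ricci_flat G -> partial J (partial I L) p = 0.
Proof.
move=> flat; case: (split_ordP I) => i ->; last first.
  by rewrite partial_log_det_r; apply: derive_cst.
case: (split_ordP J) => j ->; last exact: partial2_log_det_rl.
have := ricci_ll j i p; rewrite flat mxE dtrace_christoffelE.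
by move: (partial _ _ _) => d; lra.
Qed.

(** * Volume of the canonical tori *)

(** The integrand is constant, since H does not depend on the angles. *)
Lemma torus_volE x : torus_vol G x =
  (2 * pi) ^+ n * Num.sqrt (\det (H (row_mx x 0))).
Proof.
rewrite /torus_vol -[X in X ^+ n]subr0 -cube_integral_cst; last first.
  by rewrite mulr_ge0 // pi_ge0.
congr cube_integral; apply/funext => y; congr (Num.sqrt (\det _)).
rewrite metric_block block_mxKdr.
have -> : row_mx x y = row_mx x 0 + row_mx 0 y by rewrite add_row_mx addr0 add0r.
exact: base_metric_invariant.
Qed.

Lemma torus_vol_gt0 x : 0 < torus_vol G x.
Proof.
by rewrite torus_volE mulr_gt0 ?exprn_gt0 ?mulr_gt0 ?pi_gt0 // sqrtr_gt0 base_metric_det_gt0.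
Qed.

Lemma ln_torus_vol x :
  ln (torus_vol G x) = ln ((2 * pi) ^+ n) + 2^-1 * L (row_mx x 0).
Proof.
have d0 := base_metric_det_gt0 (row_mx x 0).
rewrite torus_volE lnM ?posrE ?exprn_gt0 ?mulr_gt0 ?pi_gt0 ?sqrtr_gt0 //.
apply: (congr1 (fun z => _ + z)).
rewrite /L -[in RHS](sqr_sqrtr (ltW d0)) lnXn ?sqrtr_gt0 // -mulr_natl; by field.
Qed.

End HamiltonianKahler.

(** An invariant function is the composite of its restriction to the slice y = 0 with
the linear projection to that slice, so both are convex together. *)
Lemma convex_on_base (R : realType) (n : nat) (f : 'rV[R]_(n + n) -> R) (c s : R) :
  0 < s -> torus_invariant f ->
  convex_on_Rn (fun x : 'rV[R]_n => c + s * f (row_mx x 0)) <-> convex_on_Rn f.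
Proof.
move=> s0 inv.
have fE p : f p = f (row_mx (lsubmx p) 0).
  rewrite -(inv (row_mx (lsubmx p) 0) (rsubmx p)).
  by rewrite add_row_mx addr0 add0r hsubmxK.
rewrite !convex_on_RnP; split=> cf x y t t01.
  rewrite fE (fE x) (fE y) -(ler_pM2l s0) linearD !linearZ /=.
  have := cf (lsubmx x) (lsubmx y) t t01.
  by move: (f _) (f _) (f _) => a b d; lra.
have := cf (row_mx x 0) (row_mx y 0) t t01; rewrite !scale_row_mx !scaler0.
rewrite add_row_mx addr0 -(ler_pM2l s0).
by move: (f _) (f _) (f _) => a b d; lra.
Qed.

Theorem theorem7p1 (R : realType) (n : nat)
    (G : 'rV[R]_(n + n) -> 'M[R]_(n + n))
    (hK : kahler_metric G) (hH : hamiltonian_torus_action G) :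
  [/\ (ricci_nonpos G <-> convex_on_Rn (fun x => ln (torus_vol G x)))
      /\ (ricci_nonpos G -> convex_on_Rn (torus_vol G)),
      (ricci_nonneg G <-> concave_on_Rn (fun x => ln (torus_vol G x)))
      /\ (ricci_nonneg G -> convex_on_Rn (fun x => (torus_vol G x)^-1))
    & ricci_flat G -> affine_on_Rn (fun x => ln (torus_vol G x))].
Proof.
pose L := log_det G; have CL := log_det_class_C hK hH 2.
have CNL : class_C 2 (fun p => - L p) by apply: class_CN.
have inv : torus_invariant L := log_det_invariant hK hH.
have half : 0 < 2^-1 :> R by rewrite invr_gt0.
have lnE := ln_torus_vol hK hH; have vol0 := torus_vol_gt0 hK hH.
have nonpos : ricci_nonpos G <-> convex_on_Rn (fun x => ln (torus_vol G x)).
  under eq_fun do rewrite lnE.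
  rewrite convex_on_base // (ricci_nonposP hK hH); split=> [|cL p v].
    exact: derive2_ge0_convex.
  exact: convex_derive2_ge0.
have nonneg : ricci_nonneg G <-> concave_on_Rn (fun x => ln (torus_vol G x)).
  rewrite /concave_on_Rn; under eq_fun do rewrite lnE opprD -mulrN.
  have invN : torus_invariant (fun p => - L p) by move=> p theta; rewrite inv.
  apply: iff_trans (iff_sym (convex_on_base _ half invN)).
  rewrite (ricci_nonnegP hK hH); split=> [hess|cL p v].
    apply: derive2_ge0_convex CNL _ => p v.
    by rewrite (derive2N p v CL) oppr_ge0; exact: hess.
  by rewrite -oppr_ge0 -(derive2N p v CL); exact: convex_derive2_ge0.
split; [split=> // /nonpos|split=> // /nonneg|].
- by move=> /convex_exp; under eq_fun do rewrite lnK ?posrE //.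
- by move=> /convex_exp; under eq_fun do rewrite expRN lnK ?posrE //.
move=> flat; have aff := derive2_eq0_affine CL
  (fun I J p => ricci_flat_partial2 hK hH I J p flat).
pose a := \row_I partial I L 0 : 'rV[R]_(n + n).
exists (2^-1 *: lsubmx a), (ln ((2 * pi) ^+ n) + 2^-1 * L 0) => x.
rewrite lnE [log_det _ _]aff -/a -/L [2^-1 * _]mulrDr [LHS]addrCA; congr (_ + _).
rewrite -scalemxAl [RHS]mxE; congr (_ * _).
by rewrite -[a]hsubmxK tr_row_mx mul_row_col trmx0 mulmx0 addr0 row_mxKl.
Qed.
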